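(* Let $Q=B_DSB_D^T$. Then the spectra of the preconditioned operators $M_{BDD}\widehat{S}$ and $M_{FETI}\mathcal{F}$ satisfy $$\sigma\left(M_{BDD}\widehat{S}\right)\setminus\{1\}=\sigma\left(M_{FETI}\mathcal{F}\right)\setminus\{0,1\}.$$ Moreover, the multiplicity of any common eigenvalue $\lambda\neq0,1$ is identical for the two preconditioned operators.
   Context: All spaces are finite-dimensional real Euclidean spaces and operators are identified with matrices. Substructuring setting. $W=W_1\times\cdots\times W_N$, where $W_i$ is the space of vectors of local degrees of freedom on the interface of substructure $i$; $S=\mathrm{diag}(S_1,\dots,S_N)$ with each $S_i:W_i\to W_i$ symmetric positive semidefinite. $\widehat{W}\subset W$ is the subspace of vectors whose degrees of freedom coincide on the interfaces between substructures, $R:\widehat{W}\to W$ is the natural embedding, and $\widehat{S}=R^TSR$ is assumed positive definite. $E:W\to\widehat{W}$ is an averaging operator $E=R^TD_P$, with $D_P$ a given weight matrix, satisfying $ER=I$. $B=[B_1,\dots,B_N]$ is the matrix with one row for each degree of freedom common to a pair of substructures $i,j$, the row being zero except for one $+1$ in block $i$ and one $-1$ in block $j$, so that $Bu=0\Leftrightarrow u\in\widehat{W}$; in particular $BR=0$. $B_D=[D_{D1}B_1,\dots,D_{DN}B_N]$ with weight matrices $D_{Di}$ determined from $D_P$ so that $B_D^TB+RE=I$ (hence also $B^TB_DE^T=0$). FETI-1. $Z$ is a matrix with linearly independent columns and $\operatorname{range}Z=\operatorname{null}S$; $G=BZ$; $S^+$ denotes a generalized inverse (pseudoinverse) of $S$,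 $SS^+S=S$; $F=BS^+B^T$. For a symmetric scaling matrix $Q$ such that $G^TQG$ is invertible (here $Q=B_DSB_D^T$, the Dirichlet preconditioner), put $P=I-QG(G^TQG)^{-1}G^T$. The FETI-1 operator is $\mathcal{F}=P^TFP$ and the (Dirichlet) preconditioner is $M_{FETI}=B_DSB_D^T$ (also written $M_{FETI-1}$). BDD. $C=EZ$, $S_C=C(C^T\widehat{S}C)^{-1}C^T$ (where $C^T\widehat{S}C$ is invertible), $P_C=I-S_C\widehat{S}$, and $M_{BDD}=P_CES^+E^TP_C^T+S_C$. $\sigma(\cdot)$ denotes the set of eigenvalues. *)

(* Defs.v *)
From HB Require Import structures.
From mathcomp Require Import all_boot all_order all_algebra.
From mathcomp Require Import complex.
From mathcomp Require Import boolp classical_sets reals.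

Set Implicit Arguments.
Unset Strict Implicit.
Unset Printing Implicit Defensive.

Import Order.TTheory GRing.Theory Num.Theory.

Local Open Scope ring_scope.
Local Open Scope complex_scope.
Local Open Scope classical_set_scope.

Definition possemidefmx (R : realType) k (A : 'M[R]_k) : Prop :=
  A^T = A /\ forall x : 'cV[R]_k, 0 <= (x^T *m A *m x) 0 0.

Definition posdefmx (R : realType) k (A : 'M[R]_k) : Prop :=
  A^T = A /\ forall x : 'cV[R]_k, x != 0 -> 0 < (x^T *m A *m x) 0 0.

(* A local degree of freedom [Tagged _ k : ldof n] is the [k]-th coordinate of
   [W_i = R^(n i)], where [i] is its tag; the product [W] is
   ['cV_(\sum_i n i)].  The map [g i] numbers the local degrees of freedom of
   substructure [i] globally, so that a common degree of freedom of [i] and [j]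
   is a pair of local ones with the same image under [gdof g]. *)
Definition ldof (N : nat) (n : 'I_N -> nat) := {i : 'I_N & 'I_(n i)}.

Definition gdof (N m : nat) (n : 'I_N -> nat)
    (g : forall i, 'I_(n i) -> 'I_m) (x : ldof n) : 'I_m :=
  g (tag x) (tagged x).

Definition What (R : realType) (N m : nat) (n : 'I_N -> nat)
    (g : forall i, 'I_(n i) -> 'I_m) : set 'cV[R]_(\sum_i n i) :=
  [set u | forall x y : ldof n, gdof g x = gdof g y ->
     submxcol u (tag x) (tagged x) 0 = submxcol u (tag y) (tagged y) 0].

(* The natural embedding of [What g], identified with ['cV_m] by reading off the
   common value at each global degree of freedom (see [WhatP]). *)
Definition embedmx (R : realType) (N m : nat) (n : 'I_N -> nat)
    (g : forall i, 'I_(n i) -> 'I_m) : 'M[R]_(\sum_i n i, m) :=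
  \mxcol_i (\matrix_(k < n i, l < m) (g i k == l)%:R).

(* The rows of [B = [B_1, ..., B_N]] correspond one to one to the degrees of
   freedom common to an unordered pair of substructures; row [r] has its [+1] at
   [a r] and its [-1] at [b r].  The order of the rows and the choice of sign in
   each of them are left free. *)
Definition jump_blocks (R : realType) (N m p : nat) (n : 'I_N -> nat)
    (g : forall i, 'I_(n i) -> 'I_m) (B_ : forall i, 'M[R]_(p, n i)) : Prop :=
  exists a b : 'I_p -> ldof n,
    [/\ forall r, tag (a r) != tag (b r) /\ gdof g (a r) = gdof g (b r),
        forall x y : ldof n, tag x != tag y -> gdof g x = gdof g y ->
          exists! r, (a r = x /\ b r = y) \/ (a r = y /\ b r = x)
      & forall r i (k : 'I_(n i)),
          B_ i r k = (a r == Tagged (fun j => 'I_(n j)) k)%:R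
                     - (b r == Tagged (fun j => 'I_(n j)) k)%:R].

Definition columns_basis_null (R : realType) (w q : nat)
    (Z : 'M[R]_(w, q)) (S : 'M[R]_w) : Prop :=
  row_free Z^T /\
  forall u : 'cV[R]_w, S *m u = 0 <-> exists c : 'cV[R]_q, u = Z *m c.

(* FETI-1, with [G = B Z], [F = B S^+ B^T] and [Q] the scaling matrix. *)
Definition feti_proj (R : realType) (p q : nat)
    (Q : 'M[R]_p) (G : 'M[R]_(p, q)) : 'M[R]_p :=
  1%:M - Q *m G *m invmx (G^T *m Q *m G) *m G^T.

Definition feti_op (R : realType) (w p q : nat) (Sp : 'M[R]_w)
    (B : 'M[R]_(p, w)) (Z : 'M[R]_(w, q)) (Q : 'M[R]_p) : 'M[R]_p :=
  let P := feti_proj Q (B *m Z) in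
  let F := B *m Sp *m B^T in
  P^T *m F *m P.

Definition feti_prec (R : realType) (w p : nat)
    (S : 'M[R]_w) (BD : 'M[R]_(p, w)) : 'M[R]_p :=
  BD *m S *m BD^T.

(* BDD, with [C = E Z]. *)
Definition bdd_coarse (R : realType) (m q : nat)
    (Shat : 'M[R]_m) (C : 'M[R]_(m, q)) : 'M[R]_m :=
  C *m invmx (C^T *m Shat *m C) *m C^T.

Definition bdd_prec (R : realType) (w m q : nat) (Sp : 'M[R]_w)
    (E : 'M[R]_(m, w)) (Z : 'M[R]_(w, q)) (Shat : 'M[R]_m) : 'M[R]_m :=
  let SC := bdd_coarse Shat (E *m Z) in
  let PC := 1%:M - SC *m Shat in
  PC *m E *m Sp *m E^T *m PC^T + SC.

(* All complex eigenvalues of a real matrix.  [eigenvalue] and [eigenspace] use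
   row vectors, which changes neither the eigenvalues nor the dimensions. *)
Definition spectrum (R : realType) k (A : 'M[R]_k) : set R[i] :=
  [set z | eigenvalue (map_mx (real_complex R) A) z].

Definition alg_mult (R : realType) k (A : 'M[R]_k) (z : R[i]) : nat :=
  mup z (char_poly (map_mx (real_complex R) A)).

Definition geo_mult (R : realType) k (A : 'M[R]_k) (z : R[i]) : nat :=
  \rank (eigenspace (map_mx (real_complex R) A) z).

Lemma embedmxE (R : realType) (N m : nat) (n : 'I_N -> nat)
    (g : forall i, 'I_(n i) -> 'I_m) (v : 'cV[R]_m) i (k : 'I_(n i)) :
  submxcol (embedmx R g *m v) i k 0 = v (g i k) 0.
Proof.
rewrite /embedmx mxcol_mul mxcolK mxE (bigD1 (g i k)) //= mxE eqxx mul1r.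
by rewrite big1 ?addr0 // => l /negPf ne; rewrite mxE eq_sym ne mul0r.
Qed.

Lemma WhatP (R : realType) (N m : nat) (n : 'I_N -> nat)
    (g : forall i, 'I_(n i) -> 'I_m) (u : 'cV[R]_(\sum_i n i)) :
  What g u <-> exists v : 'cV[R]_m, u = embedmx R g *m v.
Proof.
split=> [Wu|[v ->] x y gxy]; last by rewrite !embedmxE -!/(gdof g _) gxy.
pose v : 'cV[R]_m := \col_l
  (if [pick x : ldof n | gdof g x == l] is Some x
   then submxcol u (tag x) (tagged x) 0 else 0).
exists v; apply/mxcolP => i.
apply/matrixP => k c; rewrite (ord1 c) embedmxE [RHS]mxE.
case: pickP => [x /eqP gx|none].
  exact: (Wu (Tagged (fun j => 'I_(n j)) k) x).
by have := none (Tagged (fun j => 'I_(n j)) k); rewrite /gdof eqxx.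
Qed.

Lemma jump_blocks_ker (R : realType) (N m p : nat) (n : 'I_N -> nat)
    (g : forall i, 'I_(n i) -> 'I_m) (B_ : forall i, 'M[R]_(p, n i))
    (u : 'cV[R]_(\sum_i n i)) :
  (forall i, injective (g i)) -> jump_blocks g B_ ->
  \mxrow_i B_ i *m u = 0 <-> What g u.
Proof.
move=> ginj [a [b [Hab Hex HB]]].
pose cu (x : ldof n) := submxcol u (tag x) (tagged x) 0.
have BuE r : (\mxrow_i B_ i *m u) r 0 = cu (a r) - cu (b r).
  rewrite -[u in LHS]submxcolK mul_mxrow_mxcol summxE.
  under eq_bigr do rewrite mxE.
  rewrite (sig_big_dep xpredT (fun i (_ : ordinal (n i)) => true)
    (fun i (k : 'I_(n i)) => B_ i r k * submxcol u i k 0)) /=.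
  have sel (c : ldof n) : \sum_(x : ldof n) (c == x)%:R * cu x = cu c.
    rewrite (bigD1 c) //= eqxx mul1r big1 ?addr0 // => x /negPf ne.
    by rewrite eq_sym ne mul0r.
  rewrite -[cu (a r)]sel -[cu (b r)]sel -sumrB.
  by apply: eq_bigr => -[i k] _ /=; rewrite HB mulrBl.
split=> [Bu0 x y gxy|Wu].
  have [exy|nxy] := eqVneq (tag x) (tag y).
    case: x y exy gxy => [i k] [j l] /= exy; case: _ / exy l => l.
    by move=> /ginj /= ->.
  have [r [rP _]] := Hex x y nxy gxy.
  have := BuE r; rewrite Bu0 mxE => /esym/eqP; rewrite subr_eq0 => /eqP.
  by case: rP => -[-> ->] e; rewrite -!/(cu _) e.
apply/matrixP => r c; rewrite (ord1 c) BuE mxE.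
by apply/eqP; rewrite subr_eq0; apply/eqP/Wu; case: (Hab r).
Qed.

(* Main.v *)
Require Import Defs.
From HB Require Import structures.
From mathcomp Require Import all_boot all_order all_algebra.
From mathcomp Require Import complex.
From mathcomp Require Import boolp classical_sets reals.
From mathcomp Require Import ring.

(* Put Pi = R E and Pi' = 1 - Pi = B_D^T B.  Since S Z = 0, the coarse matrices
   C^T Shat C and G^T Q G are equal, and both preconditioned operators are
   governed by the same deflated matrix N, which annihilates Z and Pi Z: up to
   cyclic permutation of the factors (and adding the complementary coarse
   projection in the case of BDD) they are Sp Pi^T N Pi and Sp Pi'^T N Pi'.
   Now N Sp N = N, and Pi is, modulo the null space of N, a projection in the
   range of Sp N whose N-adjoint is Sp Pi^T N; so these two products have the
   form P Q and (1 - P) (1 - Q) with P, Q idempotent.  The identity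
     (x - P) (x - (1 - P) (1 - Q)) (x - Q) = x (x - 1) (x - P Q)
   shows that such products have the same algebraic and geometric
   multiplicities away from 0 and 1.  Finally, 0 is not an eigenvalue of the
   BDD operator, because S is positive semidefinite and Shat definite. *)

Set Implicit Arguments.
Unset Strict Implicit.
Unset Printing Implicit Defensive.

Import Order.TTheory GRing.Theory Num.Theory.

Local Open Scope ring_scope.
Local Open Scope complex_scope.
Local Open Scope classical_set_scope.

Ltac mx_abelian := by apply/matrixP => ? ?; rewrite !mxE; ring.

(** * Multiplicities of nonzero eigenvalues under cyclic permutation *)

Definition same_mult (F : fieldType) k l (z : F) (A : 'M[F]_k) (B : 'M[F]_l) :=
  mup z (char_poly A) = mup z (char_poly B) /\
  \rank (eigenspace A z) = \rank (eigenspace B z).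

Lemma same_mult_sym (F : fieldType) k l (z : F) (A : 'M[F]_k) (B : 'M[F]_l) :
  same_mult z A B -> same_mult z B A.
Proof. by case. Qed.

Lemma same_mult_trans (F : fieldType) k l r (z : F) (A : 'M[F]_k)
    (B : 'M[F]_l) (C : 'M[F]_r) :
  same_mult z A B -> same_mult z B C -> same_mult z A C.
Proof. by rewrite /same_mult => -[-> ->]. Qed.

(** Two block eliminations compute the determinant of [J]: a column operation leaves [X - A B], and
    a row operation that scales the lower block row by [X] leaves [X - B A]. The powers of [X]
    account for the two sizes. *)
Lemma char_poly_mulmxC (R : comNzRingType) k l (A : 'M[R]_(k, l))
    (B : 'M[R]_(l, k)) :
  'X ^+ l * char_poly (A *m B) = 'X ^+ k * char_poly (B *m A).
Proof.
rewrite /char_poly /char_poly_mx !map_mxM.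
set a := map_mx _ A; set b := map_mx _ B.
pose J := block_mx 'X%:M a b 1%:M : 'M[{poly R}]_(k + l).
have detJ : \det J = \det ('X%:M - a *m b).
  have : J *m block_mx 1%:M 0 (- b) 1%:M = block_mx ('X%:M - a *m b) a 0 1%:M.
    rewrite mulmx_block !mulmx1 !mulmx0 mul1mx !add0r mulmxN; congr block_mx.
    by rewrite subrr.
  move/(congr1 determinant); rewrite det_mulmx det_lblock det_ublock !det1.
  by rewrite !mulr1.
have : block_mx 1%:M 0 (- b) 'X%:M *m J = block_mx 'X%:M a 0 ('X%:M - b *m a).
  rewrite mulmx_block !mul1mx !mul0mx !addr0 mulmx1 mulNmx; congr block_mx.
    by rewrite mul_scalar_mx mul_mx_scalar addNr.
  by rewrite mulNmx addrC.
move/(congr1 determinant); rewrite det_mulmx det_lblock det_ublock !det1.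
by rewrite detJ !det_scalar mul1r.
Qed.

(** Right multiplication by [A] sends left eigenvectors of [A B] to those of [B A]; since
    [V A B = z V] with [z] nonzero, no rank is lost. *)
Lemma rank_eigenspace_mulmx_le (F : fieldType) k l (z : F) (A : 'M[F]_(k, l))
    (B : 'M[F]_(l, k)) : z != 0 ->
  (\rank (eigenspace (A *m B) z) <= \rank (eigenspace (B *m A) z))%N.
Proof.
move=> z0; set V := eigenspace (A *m B) z.
have VAB : V *m A *m B = z *: V by rewrite -mulmxA; apply/eigenspaceP.
have /mxrankS : (V *m A <= eigenspace (B *m A) z)%MS.
  by apply/eigenspaceP; rewrite mulmxA VAB scalemxAl.
apply: leq_trans; rewrite -(eqmx_scale V z0) -VAB; exact: mxrankM_maxl.
Qed.

Lemma same_mult_mulmxC (F : fieldType) k l (z : F) (A : 'M[F]_(k, l))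
    (B : 'M[F]_(l, k)) : z != 0 -> same_mult z (A *m B) (B *m A).
Proof.
move=> z0; split; last first.
  by apply/eqP; rewrite eqn_leq !rank_eigenspace_mulmx_le.
have nrX j : ~~ root ('X ^+ j : {poly F}) z by rewrite rootE hornerXn expf_neq0.
by rewrite -(mupMr _ (nrX l)) char_poly_mulmxC mupMr.
Qed.

(** * Products of idempotents, away from the eigenvalues 0 and 1 *)

Lemma idempotent_Nroot_char_poly (F : fieldType) k (z : F) (U : 'M[F]_k) :
  z != 0 -> z != 1 -> U *m U = U -> ~~ root (char_poly U) z.
Proof.
move=> z0 z1 UU; rewrite -eigenvalue_root_char; apply/eigenvalueP => -[v vU].
suff /eqP : (z * (z - 1)) *: v = 0.
  by rewrite scaler_eq0 mulf_eq0 (negPf z0) subr_eq0 (negPf z1) /= => ->.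
rewrite mulrBr mulr1 scalerBl -scalerA -vU scalemxAl -vU -mulmxA UU.
by rewrite subrr.
Qed.

Lemma rank_eigenspace (F : fieldType) k (A : 'M[F]_k) (z : F) :
  \rank (eigenspace A z) = (k - \rank (z%:M - A)%R)%N.
Proof. by rewrite mxrank_ker -[in LHS]opprB mxrank_opp. Qed.

Lemma horner_char_poly_mx (F : fieldType) k (A : 'M[F]_k) (z : F) :
  map_mx (horner_eval z) (char_poly_mx A) = z%:M - A.
Proof.
apply/matrixP => i j.
by rewrite !mxE /horner_eval hornerD hornerN hornerMn hornerX hornerC.
Qed.

(* The hypotheses are the coefficients of
   (x - U) (x - A) (x - V) = x (x - 1) (x - B). *)
Lemma same_mult_factor (F : fieldType) k (z : F) (A B U V : 'M[F]_k) :
  z != 0 -> z != 1 -> U *m U = U -> V *m V = V ->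
  U + A + V = 1%:M + B -> U *m A + A *m V + U *m V = B -> U *m A *m V = 0 ->
  same_mult z A B.
Proof.
move=> z0 z1 UU VV e2 e1 e0.
pose c : {poly F} := 'X * ('X - 1).
have fact : char_poly_mx U *m char_poly_mx A *m char_poly_mx V
            = c *: char_poly_mx B.
  rewrite /char_poly_mx.
  move: e2 e1 e0 => /(congr1 (map_mx polyC)) e2 /(congr1 (map_mx polyC)) e1
    /(congr1 (map_mx polyC)) e0.
  move: e2 e1 e0; rewrite !(map_mxD, map_mxM, map_mx1, map_mx0).
  set u := map_mx _ U; set a := map_mx _ A; set v := map_mx _ V.
  set b := map_mx _ B => e2 e1 e0.
  rewrite !(mulmxBl, mulmxBr) e0 -!scalar_mxM.
  rewrite !(mul_scalar_mx, mul_mx_scalar, =^~ scalemxAl).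
  (* With [u v] and then [b] eliminated, only [u], [a], [v], [u a] and [a v] remain as matrix atoms
     with scalar coefficients, so [ring] applies entrywise. *)
  have -> : u *m v = b - (u *m a + a *m v) by rewrite -[X in X - _]e1 addrC addKr.
  have -> : b = u + a + v - 1%:M by rewrite e2 addrC addKr.
  apply/matrixP => i j; rewrite /c.
  set ua := u *m a; set av := a *m v; rewrite !mxE.
  by case: (i == j) => /=; ring.
have cz : c.[z] != 0.
  by rewrite /c !hornerE mulf_neq0 // subr_eq0.
have Uz := idempotent_Nroot_char_poly z0 z1 UU.
have Vz := idempotent_Nroot_char_poly z0 z1 VV.
split.
  (* Algebraic multiplicity: in the determinants, the outer factors and the power of [c] do not
     vanish at [z]. *)
  rewrite -(mupMr _ Uz) -(mupMl _ Vz) /char_poly -!det_mulmx fact detZ mupMr //.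
  by rewrite rootE horner_exp expf_neq0.
rewrite !rank_eigenspace; congr (_ - _)%N.
(* Geometric multiplicity: at [z] the outer factors are invertible and [c] is a nonzero scalar, so
   [z - A] and [z - B] have equal rank. *)
have /(congr1 (map_mx (horner_eval z))) := fact.
rewrite map_mxZ !map_mxM !horner_char_poly_mx => ez.
have unitE (W : 'M[F]_k) : ~~ root (char_poly W) z -> z%:M - W \in unitmx.
  rewrite unitmxE unitfE -horner_char_poly_mx det_map_mx.
  by rewrite rootE.
have := congr1 mxrank ez; rewrite mxrankMfree ?row_free_unit ?unitE //.
rewrite (eqmxMfull _ _) ?row_full_unit ?unitE // => ->.
by rewrite (eqmx_scale _ _).
Qed.

(** The factorization with [U = P], [V = Q] and [A = (1 - P) (1 - Q)]; its constant term vanishes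
    because [P (1 - P) = 0]. *)
Lemma same_mult_projections (F F' : fieldType) (f : {rmorphism F -> F'}) k
    (z : F') (P Q : 'M[F]_k) :
  z != 0 -> z != 1 -> P *m P = P -> Q *m Q = Q ->
  same_mult z (map_mx f (P *m Q)) (map_mx f ((1%:M - P) *m (1%:M - Q))).
Proof.
move=> z0 z1 /(congr1 (map_mx f)) + /(congr1 (map_mx f)).
rewrite !(map_mxM, map_mxB, map_mx1); move: (map_mx f P) (map_mx f Q).
move=> {}P {}Q PP QQ; apply/same_mult_sym/(same_mult_factor z0 z1 PP QQ).
- by rewrite !(mulmxBl, mulmxBr, mul1mx, mulmx1); mx_abelian.
- rewrite !(mulmxBl, mulmxBr, mul1mx, mulmx1, mulmxA).
  by rewrite PP -!mulmxA QQ; mx_abelian.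
- by rewrite mulmxA (mulmxBr P) PP mulmx1 subrr !mul0mx.
Qed.

(** This absorbs the coarse projection of BDD. As [T (1 - P) = 0], one has [(x - T) (x - (1 - P)) =
    x (x - (T + 1 - P))]; the trivial choice [U = 1] supplies the factor [x - 1]. *)
Lemma same_mult_add_complement (F F' : fieldType) (f : {rmorphism F -> F'}) k
    (z : F') (T P : 'M[F]_k) :
  z != 0 -> z != 1 -> P *m P = P -> T *m P = T ->
  same_mult z (map_mx f T) (map_mx f (T + (1%:M - P))).
Proof.
move=> z0 z1 /(congr1 (map_mx f)) + /(congr1 (map_mx f)).
rewrite !(map_mxD, map_mxM, map_mxN, map_mx1).
move: (map_mx f T) (map_mx f P) => {}T {}P PP TP.
have V0 : T *m (1%:M - P) = 0 by rewrite mulmxBr mulmx1 TP subrr.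
apply: (same_mult_factor z0 z1 (mulmx1 1%:M) (V := 1%:M - P)).
- by rewrite mulmxBr mulmx1 mulmxBl mul1mx PP subrr subr0.
- by rewrite -addrA.
- by rewrite !mul1mx V0 addr0.
- by rewrite mul1mx.
Qed.

(** * Coarse matrices and deflation, for [Pi] equal to [R E] or [B_D^T B] *)

Definition coarse_inv (F : fieldType) w q (S Pi : 'M[F]_w) (Z : 'M[F]_(w, q)) :=
  Z *m invmx (Z^T *m (Pi^T *m S *m Pi) *m Z) *m Z^T.

(* The matrix [N] above; exchanging [Pi] and [1 - Pi] leaves it unchanged
   ([deflate_projC]). *)
Definition deflate (F : fieldType) w q (S Pi : 'M[F]_w) (Z : 'M[F]_(w, q)) :=
  S - S *m Pi *m coarse_inv S Pi Z *m Pi^T *m S.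

Lemma coarse_inv_tr (F : fieldType) w q (S Pi : 'M[F]_w) (Z : 'M[F]_(w, q)) :
  S^T = S -> (coarse_inv S Pi Z)^T = coarse_inv S Pi Z.
Proof.
by move=> St; rewrite /coarse_inv !trmx_mul trmx_inv !trmx_mul !trmxK St !mulmxA.
Qed.

Lemma deflate_tr (F : fieldType) w q (S Pi : 'M[F]_w) (Z : 'M[F]_(w, q)) :
  S^T = S -> (deflate S Pi Z)^T = deflate S Pi Z.
Proof.
move=> St; rewrite /deflate; have := coarse_inv_tr Pi Z St.
move: (coarse_inv _ _ _) => L Lt.
by rewrite linearB /= !trmx_mul Lt trmxK St !mulmxA.
Qed.

Lemma coarse_inv_mulmx (F : fieldType) w q (S Pi : 'M[F]_w)
    (Z : 'M[F]_(w, q)) :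
  Z^T *m (Pi^T *m S *m Pi) *m Z \in unitmx ->
  coarse_inv S Pi Z *m (Pi^T *m S *m Pi) *m Z = Z.
Proof.
move=> uK; rewrite /coarse_inv -(mulmxA _ Z^T) -(mulmxA _ _ Z) -(mulmxA Z).
by rewrite mulVmx ?mulmx1.
Qed.

Lemma coarse_invP (F : fieldType) w q (S Pi : 'M[F]_w) (Z : 'M[F]_(w, q)) :
  Z^T *m (Pi^T *m S *m Pi) *m Z \in unitmx ->
  coarse_inv S Pi Z *m (Pi^T *m S *m Pi) *m coarse_inv S Pi Z
  = coarse_inv S Pi Z.
Proof.
move=> uK; rewrite {2}/coarse_inv -(mulmxA Z) [_ *m _ *m (Z *m _)]mulmxA.
by rewrite coarse_inv_mulmx // /coarse_inv mulmxA.
Qed.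

(* This is [R P_C E] for BDD, where [Pi = R E], and [B_D^T P^T B] for FETI-1,
   where [Pi = B_D^T B]. *)
Definition coarse_compl (F : fieldType) w q (S Pi : 'M[F]_w)
    (Z : 'M[F]_(w, q)) :=
  Pi - Pi *m coarse_inv S Pi Z *m Pi^T *m S *m Pi.

Lemma coarse_compl_tr (F : fieldType) w q (S Pi : 'M[F]_w)
    (Z : 'M[F]_(w, q)) : S^T = S ->
  (coarse_compl S Pi Z)^T
  = Pi^T - Pi^T *m S *m Pi *m coarse_inv S Pi Z *m Pi^T.
Proof.
move=> St; have := coarse_inv_tr Pi Z St; rewrite /coarse_compl.
move: (coarse_inv _ _ _) => L Lt.
by rewrite linearB /= !trmx_mul Lt trmxK St !mulmxA.
Qed.

(** With [M = Pi^T S Pi] and [L] the coarse inverse, the left side is [M - 2 M L M + M L M L M], and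
    [L M L = L] reduces it to [M - M L M]. *)
Lemma deflate_compress (F : fieldType) w q (S Pi : 'M[F]_w)
    (Z : 'M[F]_(w, q)) :
  S^T = S -> Z^T *m (Pi^T *m S *m Pi) *m Z \in unitmx ->
  (coarse_compl S Pi Z)^T *m S *m coarse_compl S Pi Z
  = Pi^T *m deflate S Pi Z *m Pi.
Proof.
move=> St /coarse_invP; rewrite coarse_compl_tr // /coarse_compl /deflate.
move: (coarse_inv _ _ _) => L LML.
have LMLr m (X : 'M_(m, w)) :
  X *m L *m Pi^T *m S *m Pi *m L = X *m L by rewrite -[in RHS]LML !mulmxA.
rewrite !(mulmxBl, mulmxBr) !mulmxA LMLr.
by rewrite subrr subr0.
Qed.

Section Deflation.

Variables (F : fieldType) (w q : nat) (S Pi : 'M[F]_w) (Z : 'M[F]_(w, q)).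
Local Notation L := (coarse_inv S Pi Z).
Local Notation N := (deflate S Pi Z).
Hypothesis SZ : S *m Z = 0.
Hypothesis uK : Z^T *m (Pi^T *m S *m Pi) *m Z \in unitmx.

Lemma deflate_ker : N *m Z = 0.
Proof. by rewrite /deflate mulmxBl -(mulmxA _ S) SZ mulmx0 subr0. Qed.

Lemma deflate_proj_ker : N *m Pi *m Z = 0.
Proof.
apply/eqP; rewrite /deflate !mulmxBl subr_eq0; apply/eqP.
by rewrite -{1}(coarse_inv_mulmx uK) !mulmxA.
Qed.

Hypothesis St : S^T = S.

(** Because [S Z = 0], replacing [Pi] by [1 - Pi] only flips the sign of [S Pi Z]. The flips cancel
    in pairs, both in the coarse matrix and in the deflation term. *)
Let SPC : S *m (1%:M - Pi) *m Z = - (S *m Pi *m Z).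
Proof. by rewrite mulmxBr mulmx1 mulmxBl SZ sub0r. Qed.

Let PCS : Z^T *m (1%:M - Pi)^T *m S = - (Z^T *m Pi^T *m S).
Proof.
by have := congr1 trmx SPC; rewrite linearN /= !trmx_mul St !mulmxA.
Qed.

Lemma coarse_mx_projC :
  Z^T *m ((1%:M - Pi)^T *m S *m (1%:M - Pi)) *m Z
  = Z^T *m (Pi^T *m S *m Pi) *m Z.
Proof.
rewrite !mulmxA PCS !mulNmx -(mulmxA _ S (_ - _)) -(mulmxA _ (S *m _)).
by rewrite SPC mulmxN opprK !mulmxA.
Qed.

Lemma coarse_inv_projC : coarse_inv S (1%:M - Pi) Z = L.
Proof. by rewrite /coarse_inv coarse_mx_projC. Qed.

Lemma deflate_projC : deflate S (1%:M - Pi) Z = N.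
Proof.
rewrite /deflate coarse_inv_projC /coarse_inv; congr (S - _).
rewrite !mulmxA SPC !mulNmx -(mulmxA _ Z^T (_ - _)^T) -(mulmxA _ (Z^T *m _) S) PCS.
by rewrite mulmxN opprK !mulmxA.
Qed.

Variables (Sp : 'M[F]_w) (C : 'M[F]_(q, w)) (D : 'M[F]_(w, q)).
(** Together these encode [S Sp S = S] and [null S = range Z]: the defects of [Sp] as a left and
    right inverse of [S] factor through [Z] and [Z^T]. *)
Hypothesis SpS : 1%:M - Sp *m S = Z *m C.
Hypothesis SSp : 1%:M - S *m Sp = D *m Z^T.
Hypothesis PP : Pi *m Pi = Pi.

Let mulmx_SpS m (X : 'M[F]_(m, w)) : X *m Z = 0 -> X *m Sp *m S = X.
Proof.
move=> XZ; apply/esym/eqP; rewrite -subr_eq0 -{1}[X]mulmx1 -mulmxA -mulmxBr.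
by rewrite SpS mulmxA XZ mul0mx.
Qed.

Let mulmx_SSp m (X : 'M[F]_(w, m)) : Z^T *m X = 0 -> S *m Sp *m X = X.
Proof.
move=> ZX; apply/esym/eqP; rewrite -subr_eq0 -{1}[X]mul1mx -mulmxBl.
by rewrite SSp -mulmxA ZX mulmx0.
Qed.

Let deflate_SpE m (X : 'M[F]_(m, w)) :
  X *m Z = 0 -> X *m Pi *m Z = 0 -> X *m Sp *m N = X.
Proof.
move=> XZ XPZ; rewrite /deflate mulmxBr !mulmxA !mulmx_SpS //.
by rewrite XPZ !mul0mx subr0.
Qed.

(** Transposing [N Pi Z = 0] gives [Z^T Pi^T N = 0]. Hence [S Sp] fixes [Pi^T N], and the deflation
    term drops out because the coarse inverse ends in [Z^T] and [Pi] is idempotent. *)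
Let NSp_NP : N *m Sp *m Pi^T *m N = Pi^T *m N.
Proof.
have NPt : Z^T *m Pi^T *m N = 0.
  have := congr1 trmx deflate_proj_ker.
  by rewrite !trmx_mul (deflate_tr _ _ St) trmx0 mulmxA.
rewrite {1}/deflate !mulmxBl -!mulmxA.
rewrite [S *m (Sp *m _)]mulmxA mulmx_SSp ?mulmxA //.
rewrite -(mulmxA _ Pi^T Pi^T) -[Pi^T *m Pi^T]trmx_mul PP.
rewrite -(mulmxA _ Z^T Pi^T) -(mulmxA _ (Z^T *m _) N) NPt.
by rewrite mulmx0 subr0.
Qed.

Lemma same_mult_deflate (F' : fieldType) (f : {rmorphism F -> F'}) (z : F') :
  z != 0 -> z != 1 ->
  same_mult z (map_mx f (Sp *m (Pi^T *m N *m Pi)))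
    (map_mx f (Sp *m ((1%:M - Pi)^T *m N *m (1%:M - Pi)))).
Proof.
move=> z0 z1.
have NN : N *m Sp *m N = N.
  by apply: deflate_SpE; [exact: deflate_ker | exact: deflate_proj_ker].
have NPX : N *m Pi *m Sp *m N = N *m Pi.
  apply: deflate_SpE; first exact: deflate_proj_ker.
  by rewrite -(mulmxA N) PP deflate_proj_ker.
move: (N) NSp_NP NN NPX => T TSpT TT TPT.
(* [P] is a [T]-adjoint of [Pi], in that [T P = Pi^T T], and [Q] represents [1 - Pi] modulo the null
   space of [T], in that [T Q = T (1 - Pi)]. *)
pose P := Sp *m Pi^T *m T; pose Q := Sp *m T *m (1%:M - Pi).
have TP : T *m P = Pi^T *m T by rewrite /P !mulmxA.
have PP' : P *m P = P.
  by rewrite {1}/P -mulmxA TP mulmxA -(mulmxA Sp) -trmx_mul PP.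
have PPC : Pi *m (1%:M - Pi) = 0 by rewrite mulmxBr mulmx1 PP subrr.
have TQ : T *m Q = T *m (1%:M - Pi) by rewrite /Q !mulmxA TT.
have QQ : Q *m Q = Q.
  rewrite {1}/Q -!mulmxA mulmxBl mul1mx mulmxBr [Pi *m Q]mulmxA TQ.
  by rewrite /Q !mulmxA TPT -(mulmxA T Pi) PPC mulmx0 subr0 mulmxA.
have QQ' : (1%:M - Q) *m (1%:M - Q) = 1%:M - Q.
  by rewrite mulmxBr mulmx1 mulmxBl mul1mx QQ subrr subr0.
(* Applied to [P] and [1 - Q], this compares [P (1 - Q)] with [(1 - P) Q], which are the two
   compressed products. *)
have := same_mult_projections f z0 z1 PP' QQ'.
rewrite subKr.
have PQ : P *m Q = P *m (1%:M - Pi) by rewrite {1}/P -mulmxA TQ mulmxA.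
have -> : P *m (1%:M - Q) = Sp *m (Pi^T *m T *m Pi).
  by rewrite mulmxBr mulmx1 PQ mulmxBr mulmx1 subKr /P !mulmxA.
suff -> : (1%:M - P) *m Q = Sp *m ((1%:M - Pi)^T *m T *m (1%:M - Pi)) by [].
rewrite mulmxBl mul1mx PQ -mulmxBl !mulmxA; congr (_ *m _).
by rewrite linearB /= trmx1 mulmxBr mulmx1 mulmxBl.
Qed.

End Deflation.

(** * Reduction of both preconditioned operators to the deflated form *)

(** Cyclic permutation turns [Q P^T B Sp B^T P] into [Sp H^T S H] with [H = B_D^T P^T B], the coarse
    complement of [Pi]. *)
Lemma feti_same_mult (K : realType) (F' : fieldType) (f : {rmorphism K -> F'})
    (w p q : nat) (S Sp : 'M[K]_w) (B BD : 'M[K]_(p, w)) (Z : 'M[K]_(w, q))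
    (Q := BD *m S *m BD^T) (Pi := BD^T *m B) (z : F') :
  S^T = S -> (B *m Z)^T *m Q *m (B *m Z) \in unitmx -> z != 0 ->
  same_mult z (map_mx f (feti_prec S BD *m feti_op Sp B Z Q))
    (map_mx f (Sp *m (Pi^T *m deflate S Pi Z *m Pi))).
Proof.
move=> St; have KE : (B *m Z)^T *m Q *m (B *m Z)
    = Z^T *m (Pi^T *m S *m Pi) *m Z.
  by rewrite /Q /Pi !trmx_mul !trmxK !mulmxA.
rewrite KE => uK z0.
pose P := feti_proj Q (B *m Z).
have HE : coarse_compl S Pi Z = BD^T *m P^T *m B.
  apply: trmx_inj; rewrite coarse_compl_tr // !trmx_mul !trmxK /P /feti_proj KE.
  rewrite mulmxBl mul1mx mulmxBr; congr (_ - _).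
  rewrite /coarse_inv /Q; move: (invmx _) => Ki.
  by rewrite /Pi !trmx_mul ?trmxK !mulmxA.
have <- : map_mx f (Sp *m B^T *m P) *m map_mx f (Q *m P^T *m B)
   = map_mx f (Sp *m (Pi^T *m deflate S Pi Z *m Pi)).
  rewrite -map_mxM -(deflate_compress St uK) HE /Q !trmx_mul !trmxK.
  by rewrite !mulmxA.
rewrite -[feti_prec _ _]/Q.
have -> : Q *m feti_op Sp B Z Q = Q *m P^T *m B *m (Sp *m B^T *m P).
  by rewrite /feti_op -/P !mulmxA.
by rewrite map_mxM; apply: same_mult_mulmxC.
Qed.

Section BDD.

Variables (K : realType) (m q : nat) (Shat : 'M[K]_m) (C : 'M[K]_(m, q)).
Hypothesis Sht : Shat^T = Shat.
Hypothesis uC : C^T *m Shat *m C \in unitmx.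
Local Notation PC := (1%:M - bdd_coarse Shat C *m Shat).

Lemma bdd_coarse_mulmx : bdd_coarse Shat C *m Shat *m C = C.
Proof.
rewrite /bdd_coarse -(mulmxA _ C^T) -(mulmxA _ _ C) -(mulmxA C).
by rewrite mulVmx ?mulmx1.
Qed.

Lemma bdd_proj_ker : PC *m C = 0.
Proof. by rewrite mulmxBl mul1mx bdd_coarse_mulmx subrr. Qed.

Lemma bdd_proj_coarse : PC *m bdd_coarse Shat C = 0.
Proof. by rewrite {2}/bdd_coarse !mulmxA bdd_proj_ker !mul0mx. Qed.

Lemma bdd_projP : PC *m PC = PC.
Proof. by rewrite mulmxBr mulmx1 mulmxA bdd_proj_coarse mul0mx subr0. Qed.

Lemma bdd_coarse_tr : (bdd_coarse Shat C)^T = bdd_coarse Shat C.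
Proof. by rewrite /bdd_coarse !trmx_mul trmx_inv !trmx_mul !trmxK Sht !mulmxA. Qed.

Lemma bdd_proj_adjoint : PC^T *m Shat = Shat *m PC.
Proof.
rewrite linearB /= trmx1 trmx_mul bdd_coarse_tr Sht mulmxBl mulmxBr mul1mx.
by rewrite mulmx1 -(mulmxA Shat).
Qed.

End BDD.

Lemma bdd_same_mult (K : realType) (F' : fieldType) (f : {rmorphism K -> F'})
    (w m q : nat) (S Sp : 'M[K]_w) (R : 'M[K]_(w, m)) (E : 'M[K]_(m, w))
    (Z : 'M[K]_(w, q)) (Shat := R^T *m S *m R) (Pi := R *m E) (z : F') :
  S^T = S -> (E *m Z)^T *m Shat *m (E *m Z) \in unitmx -> z != 0 -> z != 1 ->
  same_mult z (map_mx f (bdd_prec Sp E Z Shat *m Shat))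
    (map_mx f (Sp *m (Pi^T *m deflate S Pi Z *m Pi))).
Proof.
move=> St uC z0 z1.
have Sht : Shat^T = Shat by rewrite /Shat !trmx_mul trmxK St mulmxA.
have KE : (E *m Z)^T *m Shat *m (E *m Z) = Z^T *m (Pi^T *m S *m Pi) *m Z.
  by rewrite /Shat /Pi !trmx_mul !mulmxA.
have uK := uC; rewrite KE in uK.
have PP := bdd_projP uC; have PS := bdd_proj_adjoint (E *m Z) Sht.
have HE : coarse_compl S Pi Z
    = R *m (1%:M - bdd_coarse Shat (E *m Z) *m Shat) *m E.
  rewrite /coarse_compl mulmxBr mulmx1 mulmxBl; congr (_ - _).
  rewrite /bdd_coarse KE /coarse_inv /Shat; move: (invmx _) => Ki.
  by rewrite /Pi !trmx_mul !mulmxA.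
have BE : bdd_prec Sp E Z Shat *m Shat
   = (1%:M - bdd_coarse Shat (E *m Z) *m Shat) *m E *m Sp *m E^T
     *m (1%:M - bdd_coarse Shat (E *m Z) *m Shat)^T *m Shat
     + (1%:M - (1%:M - bdd_coarse Shat (E *m Z) *m Shat)).
  by rewrite /bdd_prec [LHS]mulmxDl subKr.
rewrite {}BE; move: (1%:M - _) PP PS HE => P PP PS HE.
have <- : map_mx f (Sp *m E^T *m P^T *m Shat) *m map_mx f (P *m E)
   = map_mx f (Sp *m (Pi^T *m deflate S Pi Z *m Pi)).
  rewrite -map_mxM -(deflate_compress St uK) HE /Shat !trmx_mul.
  by rewrite !mulmxA.
apply/same_mult_sym.
apply: (same_mult_trans (same_mult_mulmxC _ _ z0)); rewrite -map_mxM.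
rewrite (_ : P *m E *m (_ *m Shat)
   = P *m E *m Sp *m E^T *m P^T *m Shat); last by rewrite !mulmxA.
apply: same_mult_add_complement => //.
by rewrite -(mulmxA _ P^T Shat) PS -!mulmxA PP.
Qed.

(** * Factorization through the null space of [S] *)

Lemma columns_basis_null_factor (K : realType) w q k (Z : 'M[K]_(w, q))
    (S : 'M[K]_w) (X : 'M[K]_(w, k)) :
  columns_basis_null Z S -> S *m X = 0 -> exists C, X = Z *m C.
Proof.
move=> [_ kerS] SX.
suff /submxP[D XD] : (X^T <= Z^T)%MS.
  by exists D^T; rewrite -[X]trmxK XD trmx_mul trmxK.
apply/row_subP => j; have /kerS[c Xc] : S *m col j X = 0.
  by rewrite colE mulmxA SX mul0mx.
by rewrite -tr_col Xc trmx_mul submxMl.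
Qed.

(** By symmetry, [S] annihilates the transpose of [1 - S Sp]. *)
Lemma columns_basis_null_cofactor (K : realType) w q (Z : 'M[K]_(w, q))
    (S Sp : 'M[K]_w) :
  S^T = S -> columns_basis_null Z S -> S *m Sp *m S = S ->
  exists D, 1%:M - S *m Sp = D *m Z^T.
Proof.
move=> St nullS SSpS.
have [|C eC] := columns_basis_null_factor (X := (1%:M - S *m Sp)^T) nullS.
  apply: trmx_inj; rewrite trmx_mul trmxK St trmx0 mulmxBl mul1mx SSpS.
  by rewrite subrr.
by exists C^T; rewrite -[LHS]trmxK eC trmx_mul.
Qed.

(** * Semidefiniteness and invertibility of the BDD operator *)

Lemma possemidef_mxdiag (K : realType) N (n : 'I_N -> nat)
    (S_ : forall i, 'M[K]_(n i)) :
  (forall i, possemidefmx (S_ i)) -> possemidefmx (\mxdiag_i S_ i).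
Proof.
move=> psd; split; first by rewrite tr_mxdiag; apply: eq_mxdiag => i; case: (psd i).
move=> x; rewrite -[x]submxcolK tr_mxcol mul_mxrow_mxdiag mul_mxrow_mxcol summxE.
by apply: sumr_ge0 => i _; case: (psd i) => _; apply.
Qed.

(** Along the line [u + t S u] the form equals [2 t a + t^2 b] with [a] the squared norm of [S u];
    if [a > 0], it is negative for some [t < 0]. *)
Lemma possemidef_isotropic (K : realType) w (S : 'M[K]_w) (u : 'cV[K]_w) :
  possemidefmx S -> (u^T *m S *m u) 0 0 = 0 -> S *m u = 0.
Proof.
move=> [St S0] u0; pose x := S *m u.
pose a := (x^T *m x) 0 0; pose b := (x^T *m S *m x) 0 0.
have aE : a = \sum_i x i 0 ^+ 2.
  by rewrite /a !mxE; apply: eq_bigr => i _; rewrite mxE expr2.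
have a0 : 0 <= a by rewrite aE; apply: sumr_ge0 => i _; apply: sqr_ge0.
have quad t : 0 <= t * (2 * a + t * b).
  have -> : t * (2 * a + t * b) = ((u + t *: x)^T *m S *m (u + t *: x)) 0 0.
    have xtS : u^T *m S = x^T by rewrite trmx_mul St.
    have -> : (u + t *: x)^T *m S *m (u + t *: x) = u^T *m S *m u
        + t *: (x^T *m x) + t *: (x^T *m x) + (t * t) *: (x^T *m S *m x).
      rewrite [(_ + _)^T]linearD /= [(_ *: _)^T]linearZ /=.
      rewrite !(mulmxDl, mulmxDr) -!(scalemxAl, scalemxAr) scalerA xtS.
      by rewrite -(mulmxA _ S u) !addrA.
    rewrite /a /b; move: (_ *m u) (x^T *m x) (_ *m x) u0 => U V W U0.
    by rewrite !mxE U0; ring.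
  exact: S0.
have b0 : 0 <= b by apply: S0.
have /eqP : a = 0.
  apply/eqP; rewrite eq_le a0 andbT leNgt; apply/negP => a_gt0.
  (* The denominator is [b + 1] because [b] may be zero. *)
  have := quad (- (a / (b + 1))).
  have -> : - (a / (b + 1)) * (2 * a + - (a / (b + 1)) * b)
      = - (a ^+ 2 * ((b + 2) / (b + 1) ^+ 2)).
    by field; rewrite gt_eqF // ltr_wpDl.
  rewrite oppr_ge0 leNgt mulr_gt0 ?exprn_gt0 // divr_gt0 ?exprn_gt0 //;
    by rewrite ltr_wpDl.
rewrite aE psumr_eq0 => [/allP x0|i _]; last exact: sqr_ge0.
apply/colP => i; rewrite [RHS]mxE; apply/eqP; rewrite -sqrf_eq0.
by apply: x0; rewrite mem_index_enum.
Qed.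

Lemma bdd_unitmx (K : realType) (w m q : nat) (S Sp : 'M[K]_w)
    (R : 'M[K]_(w, m)) (E : 'M[K]_(m, w)) (Z : 'M[K]_(w, q)) (Shat : 'M[K]_m) :
  possemidefmx S -> posdefmx Shat -> E *m R = 1%:M -> S *m Sp *m S = S ->
  columns_basis_null Z S -> (E *m Z)^T *m Shat *m (E *m Z) \in unitmx ->
  bdd_prec Sp E Z Shat *m Shat \in unitmx.
Proof.
move=> psd [Sht pd] ER SSpS nullS uC; have [St _] := psd.
have [D SSp] := columns_basis_null_cofactor St nullS SSpS.
rewrite unitmxE unitfE -det_tr; apply/det0P => -[v' v'0 MBv'].
pose v := v'^T; have {v'0} v0 : v != 0 by rewrite trmx_eq0.
have {MBv'} : bdd_prec Sp E Z Shat *m Shat *m v = 0.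
  by apply: trmx_inj; rewrite trmx_mul trmxK MBv' trmx0.
have PP := bdd_projP uC; have PS := bdd_proj_adjoint (E *m Z) Sht.
have PC := bdd_proj_ker uC; have PSC := bdd_proj_coarse uC.
have -> : bdd_prec Sp E Z Shat *m Shat *m v
   = (1%:M - bdd_coarse Shat (E *m Z) *m Shat) *m E *m Sp *m E^T
     *m (1%:M - bdd_coarse Shat (E *m Z) *m Shat)^T *m Shat *m v
     + (1%:M - (1%:M - bdd_coarse Shat (E *m Z) *m Shat)) *m v.
  by rewrite /bdd_prec [X in X *m v = _]mulmxDl [LHS]mulmxDl subKr.
move: (1%:M - bdd_coarse _ _ *m _) PP PS PC {PSC} => P PP PS PC MBv.
(* Applying [P] splits [M v = 0] into its two terms: [1 - P] is killed, and [P] fixes the first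
   term. *)
have PTv : P *m E *m Sp *m E^T *m P^T *m Shat *m v = 0.
  move/(congr1 (mulmx P)): MBv.
  by rewrite mulmxDr mulmx0 !mulmxA PP mulmxBr mulmx1 PP subrr mul0mx addr0.
have Pv : P *m v = v.
  by apply/esym/eqP; rewrite -subr_eq0 -{1}[v]mul1mx -mulmxBl -MBv PTv add0r.
pose y := E^T *m P^T *m Shat *m v.
(* [y] is orthogonal to [Z] because [P] kills [E Z]; hence [y] lies in the range of [S] and
   [S Sp y = y]. *)
have Zy : Z^T *m y = 0.
  rewrite /y !mulmxA -[Z^T *m _]trmx_mul -[_ *m P^T]trmx_mul PC trmx0.
  by rewrite !mul0mx.
have Sy : S *m (Sp *m y) = y.
  apply/esym/eqP; rewrite -subr_eq0 -{1}[y]mul1mx mulmxA -mulmxBl SSp.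
  by rewrite -mulmxA Zy mulmx0.
have ySpy : y^T *m Sp *m y = 0.
  transitivity (v^T *m Shat *m (P *m E *m Sp *m E^T *m P^T *m Shat *m v)).
    by rewrite /y !trmx_mul !trmxK Sht !mulmxA.
  by rewrite PTv mulmx0.
(* The energy of [Sp y] is [y^T Sp y = 0], so semidefiniteness gives [S Sp y = 0]. *)
have y0 : y = 0.
  rewrite -Sy; apply: (possemidef_isotropic psd).
  have -> : (Sp *m y)^T *m S = y^T by rewrite -[in RHS]Sy [RHS]trmx_mul St.
  by rewrite mulmxA ySpy mxE.
(* As [E R = 1] and [P v = v], applying [R^T] to [y] recovers [Shat v]. *)
have Sv : Shat *m v = 0.
  have -> : Shat *m v = R^T *m y.
    rewrite /y -(mulmxA _ P^T) PS !mulmxA -(mulmxA _ P) Pv -trmx_mul ER.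
    by rewrite trmx1 mul1mx.
  by rewrite y0 mulmx0.
by have := pd v v0; rewrite -mulmxA Sv mulmx0 mxE ltxx.
Qed.

(** * Comparison of the two spectra *)

Theorem theorem6p7 (K : realType) (N m p q : nat) (n : 'I_N -> nat)
    (g : forall i, 'I_(n i) -> 'I_m)
    (S_ : forall i, 'M[K]_(n i)) (B_ : forall i, 'M[K]_(p, n i))
    (DP : 'M[K]_(\sum_i n i)) (DD : 'I_N -> 'M[K]_p)
    (Z : 'M[K]_(\sum_i n i, q)) (Sp : 'M[K]_(\sum_i n i)) :
  let S : 'M[K]_(\sum_i n i) := \mxdiag_i S_ i in
  let R : 'M[K]_(\sum_i n i, m) := embedmx K g in
  let Shat : 'M[K]_m := R^T *m S *m R in
  let E : 'M[K]_(m, \sum_i n i) := R^T *m DP in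
  let B : 'M[K]_(p, \sum_i n i) := \mxrow_i B_ i in
  let BD : 'M[K]_(p, \sum_i n i) := \mxrow_i (DD i *m B_ i) in
  let G : 'M[K]_(p, q) := B *m Z in
  let C : 'M[K]_(m, q) := E *m Z in
  let Q : 'M[K]_p := BD *m S *m BD^T in
  let MF := feti_prec S BD *m feti_op Sp B Z Q in
  let MB := bdd_prec Sp E Z Shat *m Shat in
  (forall i, injective (g i)) ->
  (forall l, exists x : ldof n, gdof g x = l) ->
  (forall i, possemidefmx (S_ i)) ->
  posdefmx Shat ->
  E *m R = 1%:M ->
  jump_blocks g B_ ->
  BD^T *m B + R *m E = 1%:M ->
  columns_basis_null Z S ->
  S *m Sp *m S = S ->
  G^T *m Q *m G \in unitmx ->
  C^T *m Shat *m C \in unitmx ->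
  spectrum MB `\` [set 1] = spectrum MF `\` [set 0; 1] /\
  (forall z : K[i], spectrum MB z -> spectrum MF z -> z <> 0 -> z <> 1 ->
     alg_mult MB z = alg_mult MF z /\ geo_mult MB z = geo_mult MF z).
Proof.
move=> S R Shat E B BD G C Q MF MB _ _ psd pd ER _ BDB nullS SSpS uG uC.
have psdS : possemidefmx S := possemidef_mxdiag psd.
have [St _] := psdS.
have SZ : S *m Z = 0.
  apply/matrixP => i j; rewrite [RHS]mxE.
  have /(proj2 nullS) : exists c, col j Z = Z *m c.
    by exists (delta_mx j 0); rewrite colE.
  by rewrite colE mulmxA -colE => /matrixP/(_ i 0); rewrite !mxE.
have [Cs SpS] : exists Cs, 1%:M - Sp *m S = Z *m Cs.
  apply: columns_basis_null_factor nullS _.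
  by rewrite mulmxBr mulmx1 mulmxA SSpS subrr.
have [D SSp] := columns_basis_null_cofactor psdS.1 nullS SSpS.
have PP : (R *m E) *m (R *m E) = R *m E.
  by rewrite mulmxA -(mulmxA R) ER mulmx1.
have BDE : BD^T *m B = 1%:M - R *m E by rewrite -BDB addrK.
have uK : Z^T *m ((R *m E)^T *m S *m (R *m E)) *m Z \in unitmx.
  by move: uC; rewrite /C /Shat !trmx_mul !mulmxA.
pose f := real_complex K : {rmorphism K -> K[i]}.
have mult z : z != 0 -> z != 1 -> same_mult z (map_mx f MB) (map_mx f MF).
  (* The chain passes from BDD to the deflated form for [R E], then to the one for
     [1 - R E = B_D^T B], then to FETI-1. *)
  move=> z0 z1; apply: (same_mult_trans (bdd_same_mult f Sp St uC z0 z1)).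
  apply: (same_mult_trans (same_mult_deflate SZ uK St SpS SSp PP f z0 z1)).
  apply: same_mult_sym.
  have := feti_same_mult f Sp St uG z0.
  by rewrite BDE (deflate_projC (R *m E) SZ St).
(* This is why only 1 is removed from the BDD spectrum. *)
have MB0 : ~ spectrum MB 0.
  rewrite /spectrum /= /eigenvalue /eigenspace raddf0 subr0 kermx_eq0.
  by rewrite row_free_unit map_unitmx (bdd_unitmx psdS pd ER SSpS nullS uC).
have specE k (A : 'M[K]_k) z :
  spectrum A z <-> \rank (eigenspace (map_mx f A) z) <> 0%N.
  rewrite /spectrum /= /eigenvalue -mxrank_eq0.
  by split=> [/eqP|] //; move/eqP.
split.
  apply/seteqP; split=> z /=.
    move=> [sz /eqP z1]; have z0 : z != 0.
      by apply: contra_not_neq MB0 => <-.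
    have [_ mz] := mult z z0 z1; split; last by case; apply/eqP.
    by apply/specE; rewrite -mz; apply/specE.
  move=> [sz nz]; have z0 : z != 0 by apply: contra_not_neq nz; left.
  have z1 : z != 1 by apply: contra_not_neq nz; right.
  have [_ mz] := mult z z0 z1; split; last exact/eqP.
  by apply/specE; rewrite mz; apply/specE.
by move=> z _ _ /eqP z0 /eqP z1; exact: mult.
Qed.
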